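(* Let $k$ be a positive integer, let $G_1,G_2$ be disjoint copies of $C_{3k+2}$, and let $f:V(G_1)\to V(G_2)$ be any function. Then $\gamma(C(C_{3k+2},f))<2\gamma(C_{3k+2})$.
   Context: For disjoint copies $G_1,G_2$ of a graph $G$ and a function $f:V(G_1)\to V(G_2)$, the functigraph $C(G,f)$ has vertex set $V(G_1)\cup V(G_2)$ and edge set $E(G_1)\cup E(G_2)\cup\{uv : u\in V(G_1), v\in V(G_2), v=f(u)\}$. $\gamma$ denotes domination number. *)

(* Defs.v *)
From mathcomp Require Import all_boot.

Set Implicit Arguments.
Unset Strict Implicit.
Unset Printing Implicit Defensive.

(* A finite simple graph on a finType T is given by its adjacency relation,
   a symmetric irreflexive [rel T]. *)

Definition dominating (T : finType) (e : rel T) (D : {set T}) : bool :=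
  [forall v, (v \in D) || [exists u in D, e u v]].

Definition domination_number (T : finType) (e : rel T) : nat :=
  #|[arg min_(D < [set: T] | dominating e D) #|D|]|.

(* Adjacency of consecutive residues mod n. This is the cycle C_n only for
   2 < n: it has a loop for n = 1 and is a single edge for n = 2. *)
Definition cycle_rel (n : nat) : rel 'I_n :=
  fun i j => (j == ordS i) || (i == ordS j).

(* The left summand is V(G_1), the right one V(G_2). *)
Definition functigraph (T : finType) (e : rel T) (f : T -> T) : rel (T + T) :=
  fun x y =>
    match x, y with
    | inl u, inl v => e u v
    | inr u, inr v => e u v
    | inl u, inr v => v == f u
    | inr v, inl u => v == f u
    end.

Lemma dominatingT (T : finType) (e : rel T) : dominating e [set: T].
Proof. by apply/forallP => v; rewrite in_setT. Qed.

Lemma domination_numberP (T : finType) (e : rel T) :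
  (exists2 D : {set T}, dominating e D & #|D| = domination_number e) /\
  (forall D : {set T}, dominating e D -> domination_number e <= #|D|).
Proof.
rewrite /domination_number; case: arg_minnP; first exact: dominatingT.
by move=> D domD minD; split=> //; exists D.
Qed.

Lemma cycle_rel_sym n : symmetric (@cycle_rel n).
Proof. by move=> i j; rewrite /cycle_rel orbC. Qed.

Lemma cycle_rel_irr n : 1 < n -> irreflexive (@cycle_rel n).
Proof.
move=> n_gt1 i; rewrite /cycle_rel orbb -val_eqE /=; apply/negbTE.
have := ltn_ord i; rewrite leq_eqVlt => /orP[/eqP iE | ltin].
  by rewrite iE modnn; apply: contraTneq n_gt1 => i0; rewrite -iE i0.
by rewrite modn_small // neq_ltn ltnSn.
Qed.

Lemma functigraph_sym (T : finType) (e : rel T) (f : T -> T) :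
  symmetric e -> symmetric (functigraph e f).
Proof. by move=> e_sym [u|u] [v|v] /=. Qed.

Lemma functigraph_irr (T : finType) (e : rel T) (f : T -> T) :
  irreflexive e -> irreflexive (functigraph e f).
Proof. by move=> e_irr [u|u] /=. Qed.

(* Main.v *)
(* Let n = 3k+2 and join a, b in Z_n when their distance along the cycle, in
   either direction, is 1 mod 3.  This graph H (the Andrasfai graph) is
   (k+1)-regular and triangle-free, and non-adjacent vertices have a common
   neighbour.  Every neighbourhood N(z) dominates C_n, and for each edge xy of H
   the complement T(x,y) of N(x) :|: N(y) has k elements and dominates
   everything but x and y.
   If f sends an edge xy of H to a non-edge, then T(x,y) in G_1 and N(z) in G_2,
   with z a common neighbour of f x and f y, form a dominating set of size 2k+1.
   Otherwise f is an endomorphism of H; 0, 3 have the common neighbour 4 and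
   1, 3 the common neighbour 2, so f 3 is adjacent to neither f 0 nor f 1 because
   H has no triangle.  Hence f 3 lies in T(f 0, f 1), and 1 |: T(2,3) in G_1
   together with T(f 0, f 1) in G_2 is dominating.
   On the other hand, a dominating set of C_n has at least n/3 elements. *)

Require Import Defs.
From mathcomp Require Import all_boot zify.

(* The truncated difference of the wrong sign is 0, and n - d = 1 mod 3 iff
   d = 1 mod 3, so no reduction mod n is needed. *)
Definition andrasfai (a b : nat) : bool :=
  ((a - b) %% 3 == 1) || ((b - a) %% 3 == 1).

Lemma andrasfaiE a b :
  andrasfai a b = (b %% 3 == (if a <= b then a + 1 else a + 2) %% 3).
Proof. by rewrite /andrasfai; case: ifP; lia. Qed.

Lemma andrasfaiC a b : andrasfai a b = andrasfai b a.
Proof. by rewrite /andrasfai orbC. Qed.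

Lemma andrasfai_irr a : andrasfai a a = false.
Proof. by rewrite /andrasfai subnn. Qed.

(** The largest of the three differences is the sum of the other two; if those are 1 mod 3, it is 2
    mod 3. *)
Lemma andrasfai_triangle_free {a b c} :
  andrasfai a b -> andrasfai b c -> andrasfai a c = false.
Proof. rewrite /andrasfai; lia. Qed.

Lemma val_ordS n (i : 'I_n) : ordS i = (if i.+1 == n then 0 else i.+1) :> nat.
Proof.
rewrite /=; have := ltn_ord i; case: eqP => [-> _|ne lt]; first exact: modnn.
by rewrite modn_small // ltn_neqAle lt andbT; apply/eqP.
Qed.

Lemma val_ord_pred n (i : 'I_n) :
  ord_pred i = (if i == 0 :> nat then n.-1 else i.-1) :> nat.
Proof.
rewrite /=; have := ltn_ord i; case: eqP => [-> n_gt0|i_neq0 ltin].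
  by rewrite add0n modn_small // prednK.
have -> : (i + n).-1 = i.-1 + n by lia.
by rewrite modnDr modn_small //; lia.
Qed.

Lemma cycle_dominated n (D : {set 'I_n}) (v : 'I_n) :
  ((v \in D) || [exists u in D, cycle_rel u v]) =
  [|| v \in D, ordS v \in D | ord_pred v \in D].
Proof.
congr (_ || _); apply/existsP/orP => [[u /andP[uD /orP[]/eqP vu]]|[vD|vD]].
- by right; rewrite vu ordSK.
- by left; rewrite -vu.
- by exists (ordS v); rewrite vD /cycle_rel eqxx orbT.
- by exists (ord_pred v); rewrite vD /cycle_rel ord_predK eqxx.
Qed.

(** A dominating set and its two shifts by one cover the cycle. *)
Lemma cycle_domination_lb n : n <= 3 * domination_number (@cycle_rel n).
Proof.
have [[D /forallP domD <-] _] := domination_numberP (@cycle_rel n).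
have cover : [set: 'I_n] \subset D :|: (@ord_pred n @: D :|: @ordS n @: D).
  apply/subsetP => v _; have := domD v; rewrite cycle_dominated !inE.
  case/or3P => [->//|vD|vD]; apply/orP; right; apply/orP; [left|right].
    by rewrite -[v]ordSK imset_f.
  by rewrite -[v]ord_predK imset_f.
have := subset_leq_card cover; rewrite cardsT card_ord.
move=> /leq_trans/(_ (leq_card_setU _ _).1) le_n; apply: leq_trans le_n _.
have [le_U _] := leq_card_setU (@ord_pred n @: D) (@ordS n @: D).
rewrite mulSn leq_add2l (leq_trans le_U) // mul2n -addnn.
by apply: leq_add; apply: leq_imset_card.
Qed.

Lemma functigraph_domination_ub {T : finType} {e : rel T} {f : T -> T}
    {D1 D2 : {set T}} :
    (forall v, ((v \in D1) || [exists u in D1, e u v]) || (f v \in D2)) ->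
    (forall v, ((v \in D2) || [exists u in D2, e u v]) || (v \in f @: D1)) ->
  domination_number (functigraph e f) <= #|D1| + #|D2|.
Proof.
move=> dom1 dom2; set D := inl @: D1 :|: inr @: D2.
have inlD u : u \in D1 -> inl u \in D by move=> uD; rewrite inE imset_f.
have inrD u : u \in D2 -> inr u \in D.
  by move=> uD; rewrite inE orbC imset_f.
have domD : dominating (functigraph e f) D.
  apply/forallP => -[v|v].
    case/orP: (dom1 v) => [/orP[/inlD->//|/existsP[u /andP[uD uv]]]|fvD];
      apply/orP; right; apply/existsP.
      by exists (inl u); rewrite inlD.
    by exists (inr (f v)); rewrite inrD //=.
  case/orP: (dom2 v) => [/orP[/inrD->//|/existsP[u /andP[uD uv]]]|];
    last case/imsetP=> u uD ->; apply/orP; right; apply/existsP.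
    by exists (inr u); rewrite inrD.
  by exists (inl u); rewrite inlD //=.
have [_ /(_ D domD) le] := domination_numberP (functigraph e f).
apply: leq_trans le (leq_trans (leq_card_setU _ _).1 _).
by apply: leq_add; apply: leq_imset_card.
Qed.

Definition nbhd {n} (x : 'I_n) : {set 'I_n} := [set v : 'I_n | andrasfai x v].

Definition edge_rest {n} (x y : 'I_n) : {set 'I_n} := ~: (nbhd x :|: nbhd y).

Lemma in_edge_rest n (x y v : 'I_n) :
  (v \in edge_rest x y) = ~~ andrasfai x v && ~~ andrasfai y v.
Proof. by rewrite !inE negb_or. Qed.

(** On each segment cut off by [x] and [y], non-adjacency to [x] and to [y] excludes two different
    residues mod 3, so one remains. *)
Lemma in_edge_rest_mod n (x y v : 'I_n) : x < y -> andrasfai x y ->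
  (v \in edge_rest x y) =
  (v %% 3 == (if v < x then x + 1 else if v < y then x + 2 else x : nat) %% 3).
Proof.
move=> lt_xy; rewrite in_edge_rest !andrasfaiE (ltnW lt_xy) => /eqP y_mod.
case: (ltngtP v x) => v_x; case: (ltngtP v y) => v_y; lia.
Qed.

Lemma edge_restC n (x y : 'I_n) : edge_rest x y = edge_rest y x.
Proof. by rewrite /edge_rest setUC. Qed.
Lemma card_nbhd k (x : 'I_(3 * k + 2)) : #|nbhd x| = k.+1.
Proof.
have ltx := ltn_ord x.
(* The neighbours of [x] are x+1, x+4, ..., x+1+3k, reduced mod 3k+2; the last one is x-1. *)
have lt_pt (j : 'I_k.+1) : (if x + 1 + 3 * j < 3 * k + 2 then x + 1 + 3 * j
    else x + 1 + 3 * j - (3 * k + 2)) < 3 * k + 2.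
  by have := ltn_ord j; case: ifP; lia.
pose pt j := Ordinal (lt_pt j).
have pt_inj : injective pt.
  move=> i j /(congr1 val) /= eq_ij; apply: val_inj => /=.
  have := ltn_ord i; have := ltn_ord j; move: eq_ij.
  by case: ifP; case: ifP; lia.
rewrite -[RHS](card_ord k.+1) -cardsT -(card_imset _ pt_inj); congr #|pred_of_set _|.
apply/setP => v; rewrite inE; have ltv := ltn_ord v; apply/idP/imsetP.
  move=> adj_xv.
  have lt_j : (if x < v then v - x - 1 else v + (3 * k + 2) - x - 1) %/ 3 < k.+1.
    by case: ifP; move: adj_xv; rewrite /andrasfai; lia.
  exists (Ordinal lt_j) => //; apply: val_inj => /=; clear lt_j.
  by move: adj_xv; rewrite /andrasfai; case: ifP; case: ifP; lia.
case=> j _ ->; have := ltn_ord j; rewrite /andrasfai /=.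
by case: ifP; lia.
Qed.

(** The two neighbourhoods are disjoint, as there are no triangles, so 3k+2 - 2(k+1) = k vertices
    remain. *)
Lemma card_edge_rest k (x y : 'I_(3 * k + 2)) :
  andrasfai x y -> #|edge_rest x y| = k.
Proof.
move=> adj_xy; rewrite cardsCs setCK card_ord cardsU !card_nbhd.
rewrite (_ : _ :&: _ = set0) ?cards0; first lia.
apply/setP => v; rewrite !inE; apply/negbTE/negP => /andP[xv yv].
by rewrite (andrasfai_triangle_free adj_xy yv) in xv.
Qed.

(** From z+1 round to z-1 the neighbours of [z] are three apart, and [z] itself lies between these
    two. *)
Lemma nbhd_dominating k (z v : 'I_(3 * k + 2)) : 0 < k ->
  (v \in nbhd z) || [exists u in nbhd z, cycle_rel u v].
Proof.
move=> k_gt0; rewrite cycle_dominated !inE val_ordS val_ord_pred.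
have := ltn_ord z; have := ltn_ord v.
case: ifP => v_last; case: ifP => v_first; rewrite !andrasfaiE;
  by do !case: ifP; lia.
Qed.

(** Both arcs between [x] and [y] have length 1 mod 3. Inside the arc from [x] to [y] the set
    consists of x+2, x+5, ..., y-2, which dominates the interior; likewise from [y] to [x]. *)
Lemma edge_rest_dominating {k} {x y v : 'I_(3 * k + 2)} :
    0 < k -> andrasfai x y -> v != x -> v != y ->
  (v \in edge_rest x y) || [exists u in edge_rest x y, cycle_rel u v].
Proof.
move=> k_gt0; wlog lt_xy : x y / x < y => [W adj_xy v_x v_y|].
  have [lt_xy|lt_yx|eq_xy] := ltngtP x y; first exact: W.
    by rewrite edge_restC W // andrasfaiC.
  by rewrite eq_xy andrasfai_irr in adj_xy.
move=> adj_xy; rewrite -!val_eqE /= cycle_dominated !in_edge_rest_mod //.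
rewrite val_ordS val_ord_pred.
move: adj_xy; rewrite andrasfaiE (ltnW lt_xy) => /eqP y_mod.
have ltx := ltn_ord x; have lty := ltn_ord y; have ltv := ltn_ord v.
case: ifP => v_last; case: ifP => v_first; do !case: ifP; lia.
Qed.

Lemma andrasfai_common_nbr {k} {x y : 'I_(3 * k + 2)} : 0 < k ->
  ~~ andrasfai x y -> exists z : 'I_(3 * k + 2), andrasfai z x && andrasfai z y.
Proof.
move=> k_gt0; wlog le_xy : x y / x <= y => [W|nadj].
  case/orP: (leq_total x y) => le; first exact: W.
  by rewrite andrasfaiC => /(W y x le)[z]; rewrite andbC; exists z.
have ltx := ltn_ord x; have lty := ltn_ord y.
(* Here y-x is 0 or 2 mod 3. If it is 2, take y-1; if 0, take y+1, or x-1 when [y] is the last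
   vertex, in which case x > 0. *)
pose z := if y.+1 < 3 * k + 2 then (if (y - x) %% 3 == 0 then y.+1 else
  y.-1) else (if (y - x) %% 3 == 0 then x.-1 else y.-1).
have ltz : z < 3 * k + 2 by rewrite /z; case: ifP; case: ifP; lia.
exists (Ordinal ltz) => /=; move: nadj; rewrite /andrasfai /z.
by case: ifP; case: ifP; lia.
Qed.

Theorem theorem4p9 (k : nat) (hk : 0 < k)
    (f : 'I_(3 * k + 2) -> 'I_(3 * k + 2)) :
  domination_number (functigraph (@cycle_rel (3 * k + 2)) f)
    < 2 * domination_number (@cycle_rel (3 * k + 2)).
Proof.
(* The lower bound gives at least k+1 for the cycle, and 2k+1 < 2(k+1). *)
suff [D1 [D2 [le_card dom1 dom2]]] : exists D1 D2 : {set 'I_(3 * k + 2)},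
    [/\ #|D1| + #|D2| <= 2 * k + 1,
      forall v, ((v \in D1) || [exists u in D1, cycle_rel u v]) || (f v \in D2)
    & forall v, ((v \in D2) || [exists u in D2, cycle_rel u v])
                || (v \in f @: D1)].
  have ub : domination_number (functigraph (@cycle_rel (3 * k + 2)) f)
    <= #|D1| + #|D2| by apply: functigraph_domination_ub.
  by have := cycle_domination_lb (3 * k + 2); lia.
have [/existsP[x /existsP[y /andP[adj_xy nadj_f]]]|f_hom] :=
  boolP [exists x : 'I_(3 * k + 2), exists y : 'I_(3 * k + 2),
    andrasfai x y && ~~ andrasfai (f x) (f y)].
  have [z /andP[z_fx z_fy]] := andrasfai_common_nbr hk nadj_f.
  exists (edge_rest x y), (nbhd z); split=> [|v|v].
  - by rewrite card_edge_rest // card_nbhd; lia.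
  - have [->|v_x] := eqVneq v x; first by rewrite [f x \in _]inE z_fx orbT.
    have [->|v_y] := eqVneq v y; first by rewrite [f y \in _]inE z_fy orbT.
    by rewrite edge_rest_dominating.
  - by rewrite nbhd_dominating.
have {}f_hom (x y : 'I_(3 * k + 2)) : andrasfai x y -> andrasfai (f x) (f y).
  move=> adj_xy; apply: contraNT f_hom => nadj.
  by apply/existsP; exists x; apply/existsP; exists y; rewrite adj_xy.
have lt4 : 4 < 3 * k + 2 by lia.
have lt2 : 2 < 3 * k + 2 by lia.
pose o i (le_i4 : i <= 4) : 'I_(3 * k + 2) := Ordinal (leq_ltn_trans le_i4 lt4).
pose o0 := o 0 isT; pose o1 := o 1 isT; pose o2 := o 2 isT.
pose o3 := o 3 isT; pose o4 := o 4 isT.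
have [f01 f12 f23] : [/\ andrasfai (f o0) (f o1), andrasfai (f o1) (f o2)
  & andrasfai (f o2) (f o3)] by split; apply: f_hom.
have [f04 f43] : andrasfai (f o0) (f o4) /\ andrasfai (f o4) (f o3).
  by split; apply: f_hom.
have nf03 := andrasfai_triangle_free f04 f43.
have nf13 := andrasfai_triangle_free f12 f23.
have f3_rest : f o3 \in edge_rest (f o0) (f o1).
  by rewrite in_edge_rest nf03 nf13.
exists (o1 |: edge_rest o2 o3), (edge_rest (f o0) (f o1)); split=> [|v|v].
- by rewrite cardsU1 !card_edge_rest //; case: (o1 \notin _); lia.
(* T(2,3) leaves only 2 and 3 undominated: 3 is dominated by its image, 2 by the added vertex 1. *)
- have [->|v_3] := eqVneq v o3; first by rewrite f3_rest orbT.
  have [->|v_2] := eqVneq v o2.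
    apply/orP; left; apply/orP; right; apply/existsP; exists o1.
    have -> : o2 = ordS o1 by apply: val_inj; rewrite /= modn_small.
    by rewrite setU11 /cycle_rel eqxx.
  have /orP[vD|/existsP[u /andP[uD uv]]] :=
    edge_rest_dominating hk (isT : andrasfai o2 o3) v_2 v_3.
    by rewrite inE vD orbT.
  apply/orP; left; apply/orP; right; apply/existsP; exists u.
  by rewrite inE uD orbT.
(* The two exceptions [f o0] and [f o1] are dominated from the first copy: 0 lies in T(2,3) and 1
   was added. *)
- have [->|v_0] := eqVneq v (f o0).
    by rewrite imset_f ?orbT // inE in_edge_rest orbT.
  have [->|v_1] := eqVneq v (f o1); first by rewrite imset_f ?setU11 ?orbT.
  by rewrite edge_rest_dominating.
Qed.
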